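(* For every prime $p\ge3$ and all integers $n,k\ge1$, the sequence $\mathbf{B}$ satisfies $B_{np^k}\equiv B_{np^{k-1}}\pmod{p^{2k}}$.
   Context: $B_n$ is Zagier's sequence $\mathbf{B}$, defined by $B_{-1}=0$, $B_0=1$ and $(n+1)^2B_{n+1}-(9n^2+9n+3)B_n+27n^2B_{n-1}=0$ for $n\ge0$; equivalently $B_n=\sum_{k=0}^{\lfloor n/3\rfloor}(-1)^k3^{n-3k}\binom n{3k}\binom{3k}{2k}\binom{2k}k$. *)

(* Defs.v *)
From mathcomp Require Import all_boot all_order all_algebra.
From mathcomp Require Import ring zify.

Set Implicit Arguments.
Unset Strict Implicit.
Unset Printing Implicit Defensive.

Import Order.TTheory GRing.Theory Num.Theory.
Local Open Scope ring_scope.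

(* These conditions determine B on all indices n >= -1; the values of B below
   -1 are irrelevant. *)
Definition zagierB_spec (B : int -> int) : Prop :=
  [/\ B (-1) = 0, B 0 = 1 &
      forall n : int, 0 <= n ->
        (n + 1) ^+ 2 * B (n + 1) - (9 * n ^+ 2 + 9 * n + 3) * B n
          + 27 * n ^+ 2 * B (n - 1) = 0].

Definition zagierB_term (n k : nat) : int :=
  (-1) ^+ k * 3 ^+ (n - 3 * k)%N
    * ('C(n, 3 * k) * 'C(3 * k, 2 * k) * 'C(2 * k, k))%N%:Z.

Definition zagierB_sum (n : nat) : int :=
  \sum_(0 <= k < (n %/ 3).+1) zagierB_term n k.

Lemma zagierB_term_small n k : (n < 3 * k)%N -> zagierB_term n k = 0.
Proof. by move=> h; rewrite /zagierB_term bin_small // !mul0n mulr0. Qed.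

Lemma zagierB_sum_wide n m : (n < 3 * m)%N ->
  zagierB_sum n = \sum_(0 <= k < m) zagierB_term n k.
Proof.
move=> h; have hm : ((n %/ 3).+1 <= m)%N by lia.
rewrite (@big_cat_nat _ _ _ (n %/ 3).+1) //= [X in _ = _ + X]big_nat_cond.
rewrite [X in _ = _ + X]big1 ?addr0 // => k; rewrite andbT => /andP [hk _].
by apply: zagierB_term_small; lia.
Qed.

Lemma zagierB_term_fact k x :
  zagierB_term (3 * k + x) k * (x`! * k`! ^ 3)%N%:Z
    = (-1) ^+ k * 3 ^+ x * ((3 * k + x)`!)%:Z.
Proof.
rewrite /zagierB_term addKn -!mulrA; congr (_ * (_ * _)); rewrite -PoszM; congr Posz.
have h1 := @bin_fact (3 * k + x) (3 * k) (leq_addr _ _).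
have h2 := @bin_fact (3 * k) (2 * k) ltac:(lia).
have h3 := @bin_fact (2 * k) k ltac:(lia).
rewrite addKn in h1; rewrite (_ : (3 * k - 2 * k = k)%N) in h2; last lia.
rewrite (_ : (2 * k - k = k)%N) in h3; last lia.
rewrite -h1 -h2 -h3 !expnS expn0; ring.
Qed.

Lemma zagierB_term_S k x :
  (x.+1)%:Z * zagierB_term (3 * k + x.+1) k
    = 3 * (3 * k + x.+1)%N%:Z * zagierB_term (3 * k + x) k.
Proof.
have h := zagierB_term_fact k x.
have h' := zagierB_term_fact k x.+1.
apply: (@mulIf _ (x`! * k`! ^ 3)%N%:Z).
  by rewrite eqz_nat -lt0n muln_gt0 expn_gt0 !fact_gt0.
rewrite -[RHS]mulrA h.
transitivity (zagierB_term (3 * k + x.+1) k * ((x.+1)`! * k`! ^ 3)%N%:Z).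
  by rewrite factS !PoszM; ring.
by rewrite h' !addnS factS PoszM exprS; ring.
Qed.

Lemma zagierB_term_Sk k x :
  27 * k.+1%:Z ^+ 3 * zagierB_term (3 * k.+1 + x) k.+1
    = - (x.+1%:Z * x.+2%:Z * x.+3%:Z) * zagierB_term (3 * k.+1 + x) k.
Proof.
have h := zagierB_term_fact k.+1 x.
have h' := zagierB_term_fact k x.+3.
rewrite (_ : (3 * k + x.+3 = 3 * k.+1 + x)%N) in h'; last lia.
apply: (@mulIf _ (x`! * k`! ^ 3)%N%:Z).
  by rewrite eqz_nat -lt0n muln_gt0 expn_gt0 !fact_gt0.
transitivity (27 * (zagierB_term (3 * k.+1 + x) k.+1 * (x`! * (k.+1)`! ^ 3)%N%:Z)).
  by rewrite factS !expnS expn0 !PoszM; ring.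
rewrite h.
transitivity (- (zagierB_term (3 * k.+1 + x) k * ((x.+3)`! * k`! ^ 3)%N%:Z)).
  by rewrite h' !exprS; ring.
by rewrite !factS !PoszM; ring.
Qed.

Definition zagierB_lhs (n k : nat) : int :=
  (n%:Z + 2) ^+ 2 * zagierB_term n.+2 k
  - (9 * (n%:Z + 1) ^+ 2 + 9 * (n%:Z + 1) + 3) * zagierB_term n.+1 k
  + 27 * (n%:Z + 1) ^+ 2 * zagierB_term n k.

(* Wilf-Zeilberger certificate: for k >= 1,
   zagierB_lhs n k = zagierB_cert n.+1 k - zagierB_cert n.+1 k.-1. *)
Definition zagierB_cert (n k : nat) : int :=
  3 * (n%:Z - 3 * k%:Z) * (n%:Z - 3 * k%:Z - 1) * zagierB_term n k.

Lemma zagierB_lhs_ge k x :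
  (x%:Z + 2) * zagierB_lhs (3 * k + x) k
    = (81 * k%:Z ^+ 3 + 3 * (x%:Z + 2) * (x%:Z + 1) * x%:Z)
        * zagierB_term (3 * k + x).+1 k.
Proof.
have h1 := zagierB_term_S k x; have h2 := zagierB_term_S k x.+1.
rewrite /zagierB_lhs; move: h1 h2; rewrite !addnS.
move: (zagierB_term _ _) (zagierB_term _ _) (zagierB_term _ _) => c a b.
have -> : (3 * k + x).+1%:Z = 3 * k%:Z + x%:Z + 1 by lia.
have -> : (3 * k + x).+2%:Z = 3 * k%:Z + x%:Z + 2 by lia.
have -> : (3 * k + x)%N%:Z = 3 * k%:Z + x%:Z by lia.
have -> : x.+1%:Z = x%:Z + 1 by lia.
have -> : x.+2%:Z = x%:Z + 2 by lia.
move: k%:Z x%:Z => K X h1 h2.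
transitivity ((3 * K + X + 2) ^+ 2 * ((X + 2) * c)
  - (X + 2) * (9 * (3 * K + X + 1) ^+ 2 + 9 * (3 * K + X + 1) + 3) * b
  + 9 * (X + 2) * (3 * K + X + 1) * (3 * (3 * K + X + 1) * a)); first by ring.
by rewrite h2 -h1; ring.
Qed.

Lemma zagierB_lhs_S n k :
  zagierB_lhs n k.+1 = zagierB_cert n.+1 k.+1 - zagierB_cert n.+1 k.
Proof.
case: (leqP (3 * k.+1) n) => [hn|].
  have [x ->] : exists x, n = (3 * k.+1 + x)%N by exists (n - 3 * k.+1)%N; lia.
  apply: (@mulfI _ (x%:Z + 2)); first by lia.
  rewrite zagierB_lhs_ge /zagierB_cert -addnS.
  have := zagierB_term_Sk k x.+1.
  move: (zagierB_term _ _) (zagierB_term _ _) => a b.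
  have -> : (3 * k.+1 + x.+1)%N%:Z = 3 * k%:Z + x%:Z + 4 by lia.
  have -> : k.+1%:Z = k%:Z + 1 by lia.
  have -> : x.+2%:Z = x%:Z + 2 by lia.
  have -> : x.+3%:Z = x%:Z + 3 by lia.
  have -> : x.+4%:Z = x%:Z + 4 by lia.
  move: k%:Z x%:Z => K X h.
  transitivity (3 * (27 * (K + 1) ^+ 3 * b) + 3 * (X + 2) * (X + 1) * X * b).
    by ring.
  by rewrite h; ring.
rewrite leq_eqVlt => /orP [/eqP hn|].
  have -> : n = (3 * k + 2)%N by lia.
  have h1 := zagierB_term_S k.+1 0.
  have h2 := zagierB_term_Sk k 0.
  rewrite /zagierB_lhs /zagierB_cert (@zagierB_term_small (3 * k + 2)); last lia.
  have e1 : (3 * k + 2).+1 = (3 * k.+1 + 0)%N by lia.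
  have e2 : (3 * k + 2).+2 = (3 * k.+1 + 1)%N by lia.
  rewrite e2 e1; move: h1 h2.
  move: (zagierB_term _ _) (zagierB_term _ _) (zagierB_term _ _) => a b c.
  have -> : (3 * k.+1 + 1)%N%:Z = 3 * k%:Z + 4 by lia.
  have -> : (3 * k.+1 + 0)%N%:Z = 3 * k%:Z + 3 by lia.
  have -> : (3 * k + 2)%N%:Z = 3 * k%:Z + 2 by lia.
  have -> : k.+1%:Z = k%:Z + 1 by lia.
  move: k%:Z => K; rewrite mul1r => -> h2.
  transitivity (3 * (27 * (K + 1) ^+ 3 * b)); first by ring.
  by rewrite h2; ring.
rewrite leq_eqVlt => /orP [/eqP hn|hn].
  have -> : n = (3 * k + 1)%N by lia.
  have h1 := zagierB_term_S k 2.
  have h2 := zagierB_term_Sk k 0.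
  rewrite /zagierB_lhs /zagierB_cert (@zagierB_term_small (3 * k + 1)); last lia.
  rewrite !(@zagierB_term_small (3 * k + 1).+1 k.+1); try lia.
  move: h1 h2.
  rewrite (_ : (3 * k.+1 + 0 = (3 * k + 1).+2)%N); last lia.
  rewrite (_ : (3 * k + 3 = (3 * k + 1).+2)%N); last lia.
  rewrite (_ : (3 * k + 2 = (3 * k + 1).+1)%N); last lia.
  move: (zagierB_term _ _) (zagierB_term _ _) (zagierB_term _ _) => c a b.
  have -> : (3 * k + 1).+2%N%:Z = 3 * k%:Z + 3 by lia.
  have -> : (3 * k + 1).+1%N%:Z = 3 * k%:Z + 2 by lia.
  have -> : (3 * k + 1)%N%:Z = 3 * k%:Z + 1 by lia.
  have -> : k.+1%:Z = k%:Z + 1 by lia.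
  have : 3 * (k%:Z + 1) != 0 by lia.
  move: k%:Z => K hK h1 h2; apply: (mulfI hK).
  transitivity (27 * (K + 1) ^+ 3 * c); first by ring.
  transitivity (- 2 * (3 * b)); first by rewrite h2; ring.
  by rewrite h1; ring.
rewrite /zagierB_lhs /zagierB_cert !(@zagierB_term_small _ k.+1); try lia.
case: (ltnP n.+1 (3 * k)) => h; first by rewrite !zagierB_term_small; lia.
have [e|e] : n.+1 = (3 * k)%N \/ n.+1 = (3 * k + 1)%N by lia.
  by rewrite e PoszM; ring.
by rewrite e PoszD PoszM; ring.
Qed.

Lemma zagierB_sum_lhs n K :
  \sum_(0 <= k < K.+1) zagierB_lhs n k = zagierB_cert n.+1 K.
Proof.
elim: K => [|K IH]; last by rewrite big_nat_recr //= IH zagierB_lhs_S; ring.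
rewrite big_nat1; apply: (@mulfI _ (n%:Z + 2)); first by lia.
have := zagierB_lhs_ge 0 n; rewrite muln0 add0n => ->.
rewrite /zagierB_cert (_ : n.+1%:Z = n%:Z + 1); last lia.
ring.
Qed.

Lemma zagierB_sum_rec n :
  (n%:Z + 2) ^+ 2 * zagierB_sum n.+2
  - (9 * (n%:Z + 1) ^+ 2 + 9 * (n%:Z + 1) + 3) * zagierB_sum n.+1
  + 27 * (n%:Z + 1) ^+ 2 * zagierB_sum n = 0.
Proof.
have := zagierB_sum_lhs n n.+1.
rewrite /zagierB_cert zagierB_term_small ?mulr0; last lia.
rewrite /zagierB_lhs big_split sumrB /= -!mulr_sumr.
by rewrite -!zagierB_sum_wide //; clear; lia.
Qed.

(* The explicit binomial sum satisfies the recurrence, so an integer sequence as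
   in zagierB_spec exists. *)
Lemma zagierB_spec_sum :
  zagierB_spec (fun n : int => if n is Posz m then zagierB_sum m else 0).
Proof.
have s0 : zagierB_sum 0 = 1 by rewrite /zagierB_sum big_nat1.
have s1 : zagierB_sum 1 = 3.
  by rewrite /zagierB_sum big_nat1 /zagierB_term !muln0 !bin0 expr0 expr1.
set f := (fun n : int => _).
have f1 : f (0 + 1) = 3 by exact: s1.
have f0 : f 0 = 1 by exact: s0.
split => // -[[|n]|//] _; first by rewrite f1 f0; ring.
have -> : n.+1%:Z + 1 = n.+2%:Z by lia.
have -> : n.+1%:Z - 1 = n%:Z by lia.
transitivity ((n%:Z + 2) ^+ 2 * f n.+2%:Z
  - (9 * (n%:Z + 1) ^+ 2 + 9 * (n%:Z + 1) + 3) * f n.+1%:Z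
  + 27 * (n%:Z + 1) ^+ 2 * f n%:Z); last exact: zagierB_sum_rec.
move: (f _) (f _) (f _) => a b c; have -> : n.+1%:Z = n%:Z + 1 by lia.
ring.
Qed.

(* Main.v *)
(** Since [1 + x^3 + y^3 - 3 x y] is the product over [i] of the linear forms
    [1 + w^i x + w^(2 i) y], where [w] is a primitive cube root of unity,
    [(-1)^N B_N], the coefficient of [x^N y^N] in its [N]-th power, is the sum
    over the 3x3 tables [M] with all row and column sums [N] of [w^(e M) T(M)],
    where [T(M)] is the product of the multinomial coefficients of the rows and
    [e M = \sum i j M_ij].  Let [N = p N'] with [p^(k-1) | N'].  Tables with an
    entry prime to [p] contribute [0] modulo [p^(2k)], because two of their rows
    have multinomials divisible by [p^k]; and [T(p M') = T(M')] modulo [p^(2k)].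
    If [p <> 3], multiplying the exponent by [p] at most conjugates [w^(e M')],
    and the sum is real.  If [p = 3], the exponents disappear, and the error is
    three times the sum of [T(M')] over the tables with [e M'] prime to [3];
    cyclic shifts of the columns show that this sum is divisible by
    [3^(2k - 1)]. *)
Require Import Defs.
From mathcomp Require Import all_boot all_order all_algebra all_field.
From mathcomp Require Import ring zify.

Set Implicit Arguments.
Unset Strict Implicit.
Unset Printing Implicit Defensive.

Import Order.TTheory GRing.Theory Num.Theory.
Local Open Scope ring_scope.

(** * Multinomial coefficients and the part of a factorial prime to [p] *)

Definition multinomial (I : finType) (f : I -> nat) : nat :=
  ((\sum_i f i)`! %/ \prod_i (f i)`!)%N.

(** For [p > 0] this is [(p m)! / (p ^ m m!)], as [p_fact] shows. The strict upper bound omits only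
    [p m], itself a multiple of [p]. *)
Definition p_free_fact (p m : nat) : nat :=
  (\prod_(0 <= j < p * m | ~~ (p %| j)) j)%N.

Section Multinomial.
Local Open Scope nat_scope.

Lemma dvdn_fact_mul a b : a`! * b`! %| (a + b)`!.
Proof. by rewrite -(bin_fact (leq_addr b a)) addKn dvdn_mull. Qed.

Lemma dvdn_prod_fact (I : finType) (P : pred I) (f : I -> nat) :
  \prod_(i | P i) (f i)`! %| (\sum_(i | P i) f i)`!.
Proof.
apply: (big_ind2 (fun x y => x %| y`!)) => // x1 y1 x2 y2 h1 h2.
exact: dvdn_trans (dvdn_mul h1 h2) (dvdn_fact_mul _ _).
Qed.

Lemma multinomial_fact (I : finType) (f : I -> nat) :
  multinomial f * \prod_i (f i)`! = (\sum_i f i)`!.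
Proof. by rewrite divnK // dvdn_prod_fact. Qed.

Lemma prod_fact_gt0 (I : finType) (f : I -> nat) : 0 < \prod_i (f i)`!.
Proof. by rewrite prodn_gt0 // => i; apply: fact_gt0. Qed.

Lemma eq_multinomial (I : finType) (f g : I -> nat) :
  f =1 g -> multinomial f = multinomial g.
Proof.
move=> e; rewrite /multinomial; congr (_`! %/ _).
  by apply: eq_bigr => i _; rewrite e.
by apply: eq_bigr => i _; rewrite e.
Qed.

Lemma multinomial_bij (I : finType) (f : I -> nat) (h : I -> I) :
  bijective h -> multinomial (fun i => f (h i)) = multinomial f.
Proof.
move=> bh; rewrite /multinomial [in RHS](reindex h) /=; last exact: onW_bij.
by rewrite [X in _ = _ %/ X](reindex h) //; apply: onW_bij.
Qed.

(** If [f j] is positive, lowering it by one gives another multinomial coefficient [c], and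
    [f j * multinomial f] is the sum of [f] times [c]. *)
Lemma dvdn_mul_multinomial (I : finType) (f : I -> nat) (j : I) :
  \sum_i f i %| f j * multinomial f.
Proof.
case ej: (f j) => [|a]; first by rewrite mul0n dvdn0.
have hs : \sum_i f i = (a + \sum_(i | i != j) f i).+1 by rewrite (bigD1 j) //= ej.
have hp : \prod_i (f i)`! = a.+1 * (a`! * \prod_(i | i != j) (f i)`!).
  by rewrite (bigD1 j) //= ej factS mulnA.
have hd : a`! * \prod_(i | i != j) (f i)`! %| (a + \sum_(i | i != j) f i)`!.
  exact: dvdn_trans (dvdn_mul (dvdnn _) (dvdn_prod_fact _ _)) (dvdn_fact_mul _ _).
have h := multinomial_fact f; have := prod_fact_gt0 f; move: h.
rewrite hp hs factS; set b := a`! * _ in hd *.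
case/dvdnP: hd => c ->; move: (_ + _).+1 => s h hb.
apply/dvdnP; exists c; apply/eqP; rewrite -(eqn_pmul2r (_ : 0 < b)); last first.
  by move: hb; case: (b) => //; rewrite muln0.
by apply/eqP; move: h; rewrite [LHS]mulnCA -!mulnA [in RHS]mulnCA => <-; rewrite mulnCA.
Qed.

Lemma fact_addn a b : (a + b)`! = a`! * \prod_(0 <= i < b) (a + i).+1.
Proof.
elim: b => [|b IH]; first by rewrite addn0 big_geq ?muln1.
by rewrite addnS factS IH big_nat_recr //= mulnC mulnA.
Qed.

Lemma p_free_factS p m : 0 < p ->
  p_free_fact p m.+1 = p_free_fact p m * \prod_(0 <= i < p.-1) (p * m + i).+1.
Proof.
move=> p0; rewrite /p_free_fact mulnS addnC.
rewrite (@big_cat_nat _ _ _ (p * m)) ?leq_addr //=; congr (_ * _).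
rewrite -{1}[p * m]add0n big_addn addKn.
rewrite -[X in \prod_(0 <= _ < X | _) _](prednK p0) big_mkcond big_nat_recl //=.
rewrite add0n dvdn_mulr //= mul1n; apply: eq_big_nat => i /andP[_ hi].
by rewrite dvdn_addl ?dvdn_mulr // gtnNdvd //=; lia.
Qed.

Lemma p_fact p m : 0 < p -> (p * m)`! = p ^ m * m`! * p_free_fact p m.
Proof.
move=> p0; elim: m => [|m IH]; first by rewrite muln0 /p_free_fact muln0 big_geq.
rewrite mulnS addnC -{2}(prednK p0) addnS factS fact_addn IH p_free_factS //.
rewrite -addnS prednK // factS expnS -[X in X * _ = _]mulnSr; lia.
Qed.

(** Substituting [p_fact] in every factorial produces the same power of [p] on both sides, because
    the exponents [f i] add up to that of the total. *)
Lemma multinomial_scale (I : finType) p (f : I -> nat) : 0 < p ->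
  multinomial (fun i => p * f i) * \prod_i p_free_fact p (f i)
    = multinomial f * p_free_fact p (\sum_i f i).
Proof.
move=> p0; have h := multinomial_fact (fun i => p * f i).
have h' := multinomial_fact f.
rewrite -big_distrr /= p_fact // -h' in h.
rewrite (eq_bigr (fun i => p ^ f i * (f i)`! * p_free_fact p (f i))) in h; last first.
  by move=> i _; apply: p_fact.
rewrite !big_split -expn_sum /= in h.
apply/eqP; rewrite -(eqn_pmul2l (_ : 0 < p ^ (\sum_i f i) * \prod_i (f i)`!)); last first.
  by rewrite muln_gt0 expn_gt0 p0 prod_fact_gt0.
by apply/eqP; move: h; lia.
Qed.

Lemma eq_modn_prod (I : Type) (r : seq I) (P : pred I) (F G : I -> nat) d :
  (forall i, P i -> F i = G i %[mod d]) ->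
  \prod_(i <- r | P i) F i = \prod_(i <- r | P i) G i %[mod d].
Proof.
move=> h; apply: (big_ind2 (fun x y => x = y %[mod d])) => // x1 x2 y1 y2 h1 h2.
by rewrite -modnMm h1 h2 modnMm.
Qed.

Lemma coprime_prodr (I : Type) (r : seq I) (P : pred I) (F : I -> nat) p :
  (forall i, P i -> coprime p (F i)) -> coprime p (\prod_(i <- r | P i) F i).
Proof.
move=> h; apply: (big_ind (fun x => coprime p x)) => //; first exact: coprimen1.
by move=> x y; rewrite coprimeMr => -> ->.
Qed.

Lemma coprime_p_free_fact p m : prime p -> coprime p (p_free_fact p m).
Proof. by move=> pp; apply: coprime_prodr => i; rewrite prime_coprime. Qed.

Lemma eqz_nat_mod (a b d : nat) :
  reflect (a = b %[mod d]) (d%:Z %| (a%:Z - b%:Z)%R)%Z.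
Proof.
rewrite -eqz_mod_dvd !modz_nat; apply: (iffP eqP) => [[]//|->//].
Qed.

(* Pairing [j] with [q - j] gives [(q c + j) (q c + q - j) = j (q - j)] modulo
   [q ^ 2], so the two products have the same square; they also agree modulo [p],
   so for odd [p] their sum is a unit. *)
Lemma p_free_block p s c : prime p -> 2 < p ->
  \prod_(0 <= j < p ^ s.+1 | ~~ (p %| j)) (p ^ s.+1 * c + j)
    = \prod_(0 <= j < p ^ s.+1 | ~~ (p %| j)) j %[mod p ^ (2 * s.+1)].
Proof.
move=> pp p2; set q := p ^ s.+1.
have q0 : 0 < q by rewrite expn_gt0 prime_gt0.
have pq : p %| q by rewrite /q expnS dvdn_mulr.
(* Starting at 1 drops only [j = 0], already excluded as a multiple of [p], and makes the range
   stable under [j -> q - j]. *)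
have eK c' : \prod_(0 <= j < q | ~~ (p %| j)) (q * c' + j)
    = \prod_(1 <= j < q | ~~ (p %| j)) (q * c' + j).
  by rewrite big_ltn_cond // dvdn0.
pose K c' := \prod_(1 <= j < q | ~~ (p %| j)) (q * c' + j).
have e0 : \prod_(0 <= j < q | ~~ (p %| j)) j = K 0.
  by rewrite /K -eK; apply: eq_bigr => j _; rewrite muln0.
rewrite eK e0 -/(K c) -/(K 0) mulnC expnM -/q.
have eR c' : K c' = \prod_(1 <= j < q | ~~ (p %| j)) (q * c' + (q - j)).
  rewrite /K big_nat_rev /= big_nat_cond [RHS]big_nat_cond.
  apply: eq_big => [j|j _]; last by rewrite add1n subSS.
  rewrite add1n subSS; case: (boolP (1 <= j < q)) => //= /andP[_ hj].
  by congr (~~ _); rewrite -(dvdn_subr (ltnW hj)).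
have sq : K c * K c = K 0 * K 0 %[mod q ^ 2].
  have sqK c' : K c' * K c' = \prod_(1 <= j < q | ~~ (p %| j))
      ((q * c' + j) * (q * c' + (q - j))) by rewrite {2}eR -big_split.
  rewrite !sqK; rewrite big_nat_cond [in RHS]big_nat_cond.
  apply: eq_modn_prod => j /andP[/andP[_ hj] _].
  have -> : (q * c + j) * (q * c + (q - j)) = (c * c + c) * q ^ 2 + j * (q - j).
    have : q - j + j = q by rewrite subnK // ltnW.
    move: (q - j) => r <-; nia.
  by rewrite modnMDl muln0 !add0n.
have modp : K c = K 0 %[mod p].
  apply: eq_modn_prod => j _.
  by rewrite muln0 add0n -(divnK pq) mulnAC modnMDl.
have cop : coprime p (K c + K 0).
  rewrite -coprime_modr -modnDml modp modnDml coprime_modr addnn -mul2n coprimeMr.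
  rewrite coprimen2.
  have -> /= : odd p by apply: contraTT p2 => /(prime_oddPn pp) ->.
  by apply: coprime_prodr => j; rewrite muln0 add0n prime_coprime.
have cz : coprimez (q ^ 2)%:Z ((K c)%:Z + (K 0)%:Z)%R.
  by rewrite /coprimez -PoszD; apply: coprimeXl; apply: coprimeXl.
apply/eqz_nat_mod; rewrite -(Gauss_dvdzl _ cz).
move/eqz_nat_mod: sq; rewrite !PoszM; congr (dvdz _ _); ring.
Qed.

(** The range splits into [A] blocks of length [p ^ s.+1], each congruent to the first by
    [p_free_block]. *)
Lemma p_free_fact_exp p s A : prime p -> 2 < p ->
  p_free_fact p (p ^ s * A) = p_free_fact p (p ^ s) ^ A %[mod p ^ (2 * s.+1)].
Proof.
move=> pp p2; elim: A => [|A IH]; first by rewrite muln0 /p_free_fact muln0 big_geq.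
have pq : p %| p ^ s.+1 by rewrite expnS dvdn_mulr.
have -> : p_free_fact p (p ^ s * A.+1) = p_free_fact p (p ^ s * A)
    * \prod_(0 <= j < p ^ s.+1 | ~~ (p %| j)) (p ^ s.+1 * A + j).
  rewrite /p_free_fact !mulnA -!expnS mulnSr.
  rewrite (@big_cat_nat _ _ _ (p ^ s.+1 * A)) ?leq_addr //=; congr (_ * _).
  rewrite -{1}[p ^ s.+1 * A]add0n big_addn addKn.
  apply: eq_big => j; last by rewrite addnC.
  by rewrite dvdn_addl // dvdn_mulr.
have e : \prod_(0 <= j < p ^ s.+1 | ~~ (p %| j)) j = p_free_fact p (p ^ s).
  by rewrite /p_free_fact -expnS.
by rewrite -modnMm IH p_free_block // e modnMm -expnSr.
Qed.

(** By [p_free_fact_exp] both sides are powers of [p_free_fact p (p ^ s)] with the same total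
    exponent. *)
Lemma p_free_fact_sum (I : finType) p s (f : I -> nat) :
  prime p -> 2 < p -> (forall i, p ^ s %| f i) ->
  p_free_fact p (\sum_i f i) = \prod_i p_free_fact p (f i) %[mod p ^ (2 * s.+1)].
Proof.
move=> pp p2 h; have ef i : f i = p ^ s * (f i %/ p ^ s) by rewrite mulnC divnK.
under eq_bigr do rewrite ef.
rewrite -big_distrr p_free_fact_exp // expn_sum; apply/esym/eq_modn_prod => i _.
by rewrite ef p_free_fact_exp // -ef.
Qed.

End Multinomial.

(** * Weights of magic tables modulo powers of [p] *)

Section Tables.
Local Open Scope nat_scope.
Variable I : finType.
Implicit Types (m : I -> I -> nat) (N : nat).

Definition table_weight m : nat := \prod_i multinomial (m i).

Definition magic N m : bool :=
  [forall i, \sum_j m i j == N] && [forall j, \sum_i m i j == N].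

Lemma magicP N m :
  reflect ((forall i, \sum_j m i j = N) /\ (forall j, \sum_i m i j = N)) (magic N m).
Proof.
apply: (iffP andP) => [[/forallP h1 /forallP h2]|[h1 h2]].
  by split=> i; apply/eqP.
by split; apply/forallP => i; apply/eqP.
Qed.

Lemma magic_scale p N m : 0 < p ->
  magic (p * N) (fun i j => p * m i j) = magic N m.
Proof.
by move=> p0; congr (_ && _); apply: eq_forallb => i;
  rewrite -big_distrr /= eqn_pmul2l.
Qed.

(* Two entries of the column of [m i j] are not divisible by [p ^ s.+1], and each
   of their rows has a multinomial divisible by [p ^ (r - s)]. *)
Lemma dvdn_table_weight p r s N m i j : prime p -> p ^ r %| N -> magic N m ->
  ~~ (p ^ s.+1 %| m i j) -> p ^ (2 * (r - s)) %| table_weight m.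
Proof.
move=> pp pN /magicP[rows cols] hij.
case: (leqP r s) => [|sr]; first by rewrite -subn_eq0 => /eqP ->; rewrite dvd1n.
(* [N] divides the entry times the multinomial of its row; the entry absorbs at most [p ^ s] of the
   factor [p ^ r]. *)
have row i' : ~~ (p ^ s.+1 %| m i' j) -> p ^ (r - s) %| multinomial (m i').
  move=> h; have := dvdn_trans pN (_ : N %| m i' j * multinomial (m i')).
  rewrite -{1}(rows i') dvdn_mul_multinomial => /(_ isT).
  have m0 : 0 < m i' j by case: (m i' j) h => //; rewrite dvdn0.
  case: (posnP (multinomial (m i'))) => [->|M0]; first by rewrite !dvdn0.
  rewrite !pfactor_dvdn ?muln_gt0 ?m0 // lognM // in h *.
  lia.
(* As [s < r], the column sum [N] is divisible by [p ^ s.+1], so [m i j] cannot be the only entry of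
   its column that is not. *)
have [i' ii' hi'] : exists2 i', i' != i & ~~ (p ^ s.+1 %| m i' j).
  apply/exists_inP; rewrite -negb_forall_in; apply: contra hij => /forall_inP h.
  have : p ^ s.+1 %| N by apply: dvdn_trans pN; apply: dvdn_exp2l.
  rewrite -(cols j) (bigD1 i) //= dvdn_addl //.
  by apply: (big_ind (fun x => p ^ s.+1 %| x)) => // x y; apply: dvdn_add.
rewrite /table_weight (bigD1 i) // (bigD1 i') //= mulnA dvdn_mulr //.
by rewrite mul2n -addnn expnD dvdn_mul // row.
Qed.

(** Scaling multiplies the weight by the [p]-adic unit [E / D], which is 1 modulo [p ^ (2 * s.+1)];
    the pair [D], [E] keeps the statement within the naturals. *)
Lemma table_weight_scale p s m : prime p -> 2 < p ->
  (forall i j, p ^ s %| m i j) ->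
  exists D E, [/\ coprime p D, D = E %[mod p ^ (2 * s.+1)]
    & table_weight (fun i j => p * m i j) * D = table_weight m * E].
Proof.
move=> pp p2 h; exists (\prod_i \prod_j p_free_fact p (m i j)).
exists (\prod_i p_free_fact p (\sum_j m i j)); split.
- by apply: coprime_prodr => i _; apply: coprime_prodr => j _; apply: coprime_p_free_fact.
- by apply: eq_modn_prod => i _; rewrite p_free_fact_sum.
rewrite -!big_split; apply: eq_bigr => i _ /=.
by rewrite multinomial_scale // prime_gt0.
Qed.

(** Less divisible entries weaken the congruence for [E / D], but the weight then gains exactly the
    missing power of [p]: the exponents [2 * (r - s)] and [2 * s.+1] add up to [2 * r.+1]. *)
Lemma table_weight_mod p r N m : prime p -> 2 < p -> p ^ r %| N -> magic N m ->
  table_weight (fun i j => p * m i j) = table_weight m %[mod p ^ (2 * r.+1)].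
Proof.
move=> pp p2 pN mN.
(* [s] is the least index below [r] for which [p ^ s.+1] fails to divide some entry, or [r] if there
   is none; minimality gives [p ^ s] in every entry. *)
have [s [sr hs hT]] : exists s, [/\ s <= r, forall i j, p ^ s %| m i j
    & p ^ (2 * (r - s)) %| table_weight m].
  pose bad s := [exists i, exists j, ~~ (p ^ s.+1 %| m i j)].
  have nbad s : ~~ bad s -> forall i j, p ^ s.+1 %| m i j.
    by move=> /existsPn h i j; have /existsPn/(_ j)/negbNE := h i.
  have [/existsP[s0 s0b]|/existsPn good] := boolP [exists s : 'I_r, bad s].
    have ex : exists s, bad s by exists s0.
    case: (ex_minnP ex) => s /existsP[i /existsP[j hij]] smin.
    exists s; split; last exact: dvdn_table_weight pN mN hij.
      exact: leq_trans (smin _ s0b) (ltnW (ltn_ord s0)).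
    case: s smin {hij} => // s smin; apply: nbad.
    by apply/negP => /smin; rewrite ltnn.
  exists r; split=> //; last by rewrite subnn dvd1n.
  by case: r good {pN} => // r good; apply: nbad (good ord_max).
have [D [E [cD DE eq]]] := table_weight_scale pp p2 hs.
have -> : 2 * r.+1 = 2 * (r - s) + 2 * s.+1 by lia.
set T' := table_weight _ in eq *; set T := table_weight m in eq hT *.
apply/eqz_nat_mod.
have cz : coprimez (p ^ (2 * (r - s) + 2 * s.+1))%N%:Z D%:Z.
  by rewrite /coprimez; apply: coprimeXl.
(* After multiplication by the unit [D], the difference [T' - T] becomes [T * (E - D)]. *)
rewrite -(Gauss_dvdzl _ cz) mulrBl -!PoszM eq !PoszM -mulrBr expnD PoszM.
by apply: dvdz_mul => //; apply/eqz_nat_mod.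
Qed.

End Tables.

(** * Expansion of the sequence as a sum over 3x3 magic tables *)

Local Notation i0 := (@Ordinal 3 0 isT).
Local Notation i1 := (@Ordinal 3 1 isT).
Local Notation i2 := (@Ordinal 3 2 isT).

Lemma big_ord3 (T : Type) (idx : T) (op : Monoid.law idx) (F : 'I_3 -> T) :
  \big[op/idx]_i F i = op (op (F i0) (F i1)) (F i2).
Proof.
rewrite !big_ord_recl big_ord0 Monoid.mulm1 Monoid.mulmA.
by congr (op (op (F _) (F _)) (F _)); apply: val_inj.
Qed.

(** The binomial theorem is applied twice; [h] turns the two summation indices into the three
    exponents. *)
Lemma trinomial (R : comPzSemiRingType) (x : 'I_3 -> R) n :
  (\sum_j x j) ^+ n
    = \sum_(f : {ffun 'I_3 -> 'I_n.+1} | (\sum_j f j == n)%N)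
        (\prod_j x j ^+ f j) *+ multinomial (fun j => f j).
Proof.
pose h (u : 'I_n.+1 * 'I_n.+1) : {ffun 'I_3 -> 'I_n.+1} :=
  [ffun j => match val j with
             | 0 => inord (n - u.1)
             | 1 => inord (u.1 - u.2)
             | _ => u.2 end].
pose h' (f : {ffun 'I_3 -> 'I_n.+1}) := (inord (n - f i0) : 'I_n.+1, f i2).
have h0 u : h u i0 = (n - u.1)%N :> nat by rewrite ffunE /= inordK //; lia.
have h1 u : h u i1 = (u.1 - u.2)%N :> nat.
  by rewrite ffunE /= inordK //; have := ltn_ord u.1; lia.
have h2 u : h u i2 = u.2 :> nat by rewrite ffunE.
have hh' (f : {ffun 'I_3 -> 'I_n.+1}) : (\sum_j f j == n)%N -> h (h' f) = f.
  rewrite big_ord3 => /eqP ef; apply/ffunP => j; apply: ord_inj.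
  have {}ef : (f i0 + f i1 + f i2 = n)%N := ef.
  have : j \in [:: i0; i1; i2].
    by rewrite !inE; case: j => [[|[|[]]]].
  by rewrite !inE => /or3P[] /eqP->; rewrite ?h0 ?h1 ?h2 /= ?inordK //; lia.
rewrite [RHS](reindex_onto h h') // [in LHS]big_ord3 /= -addrA exprDn.
transitivity (\sum_(u : 'I_n.+1 * 'I_n.+1 | (u.2 < u.1.+1)%N)
    (x i0 ^+ (n - u.1) * (x i1 ^+ (u.1 - u.2) * x i2 ^+ u.2))
      *+ ('C(n, u.1) * 'C(u.1, u.2))).
  rewrite -(pair_big_dep xpredT (fun i j : 'I_n.+1 => (j < i.+1)%N)
    (fun i j : 'I_n.+1 => (x i0 ^+ (n - i) * (x i1 ^+ (i - j) * x i2 ^+ j))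
      *+ ('C(n, i) * 'C(i, j)))) /=.
  apply: eq_bigr => i _; rewrite exprDn mulr_sumr -sumrMnl.
  rewrite (big_ord_widen n.+1 (fun j => (x i0 ^+ (n - i) *
    (x i1 ^+ (i - j) * x i2 ^+ j *+ 'C(i, j))) *+ 'C(n, i))) //.
  by apply: eq_bigr => j _; rewrite mulrnAr -mulrnA mulnC.
apply: eq_big => [[i j]|[i j] /= ji] /=.
  rewrite big_ord3 h0 h1 h2 /= /h' -pair_eqE /= -val_eqE /=.
  have -> : h (i, j) i2 == j by apply/eqP/ord_inj; rewrite h2.
  rewrite h0 inordK; last by rewrite ltnS leq_subr.
  move: (ltn_ord i); move: (nat_of_ord i) (nat_of_ord j) => a b; rewrite ltnS => an.
  (* Since subtraction truncates, [n - a], [a - b] and [b] add up to [n] exactly when [b <= a]. *)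
  by rewrite subKn // eqxx !andbT; apply/idP/eqP; lia.
rewrite big_ord3 h0 h1 h2 /= mulrA; congr (_ *+ _).
apply/eqP; rewrite -(eqn_pmul2r (prod_fact_gt0 (fun k => h (i, j) k))).
rewrite multinomial_fact !big_ord3 h0 h1 h2 /=.
have := bin_fact (ltnSE (ltn_ord i)); have := bin_fact (ltnSE ji).
have -> : (n - i + (i - j) + j = n)%N by have := ltn_ord i; lia.
by move=> /= e <-; rewrite -e; lia.
Qed.

Definition table (N : nat) : finType := {ffun 'I_3 -> {ffun 'I_3 -> 'I_N.+1}}.

Definition entries N (M : table N) (i j : 'I_3) : nat := M i j.

Definition moment (m : 'I_3 -> 'I_3 -> nat) : nat :=
  (\sum_(i < 3) \sum_(j < 3) i * j * m i j)%N.

(* The three variables dehomogenized at the first, so that the coefficient of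
   [x ^+ N * y ^+ N * z ^+ N] becomes that of ['X ^+ N * 'Y ^+ N]. *)
Definition xyz (R : nzRingType) (j : 'I_3) : {poly {poly R}} :=
  match val j with 0 => 1 | 1 => 'X | _ => 'X%:P end.

Lemma coef_monomial2 (R : comNzRingType) (c : R) a b n :
  (c%:P%:P * ('X^a * ('X%:P) ^+ b))`_n`_n = c *+ ((a == n) && (b == n)).
Proof.
rewrite coefCM -rmorphXn coefMC coefXn eq_sym coefCM; case: (a == n).
  by rewrite mul1r coefXn eq_sym; case: (b == n); rewrite ?mulr1 ?mulr0.
by rewrite mul0r coef0 mulr0.
Qed.

(** Row [i] of a table records the exponents chosen when the [N]-th power of the [i]-th linear form
    is expanded, so the column sums are the exponents of the three variables. *)
Lemma table_sum (R : comNzRingType) (w : R) N :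
  ((\prod_(i < 3) \sum_(j < 3) (w ^+ (i * j))%:P%:P * xyz R j) ^+ N)`_N`_N
    = \sum_(M : table N | magic N (entries M))
        w ^+ moment (entries M) *+ table_weight (entries M).
Proof.
rewrite -prodrXl.
under eq_bigr do rewrite trinomial.
rewrite bigA_distr_big /= !coef_sum.
rewrite (eq_bigl (fun M : table N => [forall i, \sum_j M i j == N]%N)); last first.
  by move=> M; apply/ffun_onP/forallP.
transitivity (\sum_(M : table N | [forall i, \sum_j M i j == N]%N)
   (w ^+ moment (entries M) *+ table_weight (entries M)) *+
     ((\sum_i M i i1 == N) && (\sum_i M i i2 == N))%N).
  apply: eq_bigr => M _; rewrite -coef_monomial2; congr ((polyseq (polyseq _)`_N)`_N).
  rewrite prodrMn !rmorphMn mulrnAl; congr (_ *+ _).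
  rewrite (eq_bigr (fun i : 'I_3 => \prod_(j < 3)
      (w ^+ (i * j * entries M i j))%:P%:P * \prod_(j < 3) xyz R j ^+ M i j)); last first.
    move=> i _; rewrite -big_split; apply: eq_bigr => j _ /=.
    by rewrite exprMn -!rmorphXn -exprM.
  rewrite big_split; congr (_ * _) => /=.
    rewrite /moment expr_sum !rmorph_prod; apply: eq_bigr => i _.
    by rewrite expr_sum !rmorph_prod.
  rewrite exchange_big /= (eq_bigr (fun j => xyz R j ^+ (\sum_i M i j))); last first.
    by move=> j _; rewrite expr_sum.
  by rewrite big_ord3 /= expr1n mul1r.
rewrite (eq_bigr (fun M : table N => if (\sum_i M i i1 == N)%N && (\sum_i M i i2 == N)%N
   then w ^+ moment (entries M) *+ table_weight (entries M) else 0)); last first.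
  by move=> M _; case: ifP.
rewrite -big_mkcondr; apply: eq_bigl => M; rewrite /magic.
case: forallP => //= rows; apply/andP/forallP => [[/eqP c1 /eqP c2]|c].
  2: by split; apply: c.
(* The coefficient fixes only the last two column sums; the first follows because all entries add up
   to [3 N]. *)
have tot : (\sum_j \sum_i M i j = N + N + N)%N.
  rewrite exchange_big (eq_bigr (fun=> N)) /=; last by move=> i _; apply/eqP/rows.
  by rewrite big_ord3.
have c0 : (\sum_i M i i0 = N)%N.
  by move: tot; rewrite big_ord3 /= c1 c2 => /addIn /addIn.
move=> j; have : j \in [:: i0; i1; i2] by rewrite !inE; case: j => [[|[|[]]]].
by rewrite !inE => /or3P[] /eqP->; apply/eqP.
Qed.

Lemma cubic_factor (R : comNzRingType) (w : R) (x : 'I_3 -> R) :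
  1 + w + w ^+ 2 = 0 ->
  \prod_(i < 3) \sum_(j < 3) w ^+ (i * j) * x j
    = - 3 * (x i0 * x i1 * x i2) + \sum_j x j ^+ 3.
Proof.
move=> hw; have w3 : w ^+ 3 = 1.
  apply/eqP; rewrite -subr_eq0; apply/eqP.
  by transitivity ((w - 1) * (1 + w + w ^+ 2)); [ring | rewrite hw mulr0].
rewrite !big_ord3 /= !(mul0n, mul1n, muln0, muln1) expr0 expr1.
have -> : w ^+ (2 * 2) = w by rewrite exprS w3 mulr1.
have -> : w ^+ 2 = - 1 - w by rewrite -[RHS]addr0 -hw; ring.
have e : w * w = - 1 - w by rewrite -expr2 -[RHS]addr0 -hw; ring.
move: (x _) (x _) (x _) => a b c.
(* The correction term is the multiple of [1 + w + w ^+ 2] by which the product and the cubic form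
   differ as polynomials in [w]. *)
transitivity (- 3 * (a * b * c) + (a ^+ 3 + b ^+ 3 + c ^+ 3)
  + (w * w + 1 + w) * (- (a + b + c) * (a - b) ^+ 2)); first by ring.
by rewrite e; ring.
Qed.

Lemma multinomial_const3 k :
  multinomial (fun _ : 'I_3 => k) = ('C(3 * k, 2 * k) * 'C(2 * k, k))%N.
Proof.
apply/eqP; rewrite -(eqn_pmul2r (prod_fact_gt0 (fun _ : 'I_3 => k))).
rewrite multinomial_fact !big_ord3 /=.
have h2 := @bin_fact (3 * k) (2 * k) ltac:(lia).
have h3 := @bin_fact (2 * k) k ltac:(lia).
rewrite (_ : 3 * k - 2 * k = k)%N in h2; last lia.
rewrite (_ : 2 * k - k = k)%N in h3; last lia.
by apply/eqP; rewrite (_ : k + k + k = 3 * k)%N -?h2 -?h3; lia.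
Qed.

Lemma big_dvdn3 (V : nmodType) (F : nat -> V) m :
  \sum_(0 <= i < 3 * m | (3 %| i)%N) F i = \sum_(0 <= k < m) F (3 * k)%N.
Proof.
elim: m => [|m IH]; first by rewrite muln0 !big_geq.
rewrite [RHS]big_nat_recr //= -IH mulnS addnC addnS addnS addnS addn0.
rewrite big_mkcond !big_nat_recr //= -big_mkcond dvdn_mulr //.
have -> : (3 %| (3 * m).+1)%N = false by lia.
have -> : (3 %| (3 * m).+2)%N = false by lia.
by rewrite !addr0.
Qed.

(** In the binomial expansion [i] is the power of the sum of cubes. Only [i = 3 k] with each cube
    taken [k] times contributes, and this yields the [k]-th term of the explicit sum. *)
Lemma constant_term_zagierB (R : comNzRingType) N :
  ((- 3 * (xyz R i0 * xyz R i1 * xyz R i2) + \sum_j xyz R j ^+ 3) ^+ N)`_N`_N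
    = (-1) ^+ N * (zagierB_sum N)%:~R.
Proof.
rewrite exprDn !coef_sum.
pose c i : R := if (3 %| i)%N then
  (- 3) ^+ (N - i) *+ ('C(N, i) * multinomial (fun _ : 'I_3 => i %/ 3)%N) else 0.
transitivity (\sum_(i < N.+1) c i).
  apply: eq_bigr => -[i /= hi] _.
  rewrite trinomial mulr_sumr -sumrMnl !coef_sum.
  transitivity (\sum_(f : {ffun 'I_3 -> 'I_i.+1} | (\sum_j f j == i)%N)
     (- 3 : R) ^+ (N - i) *+ ('C(N, i) * multinomial (fun j => f j)) *+
       ((3 * f i1 == i) && (3 * f i2 == i))%N).
    apply: eq_bigr => f _.
    (* The factor [- 3 x y] contributes [N - i] to both exponents, and [i <= N]. *)
    rewrite (_ : ((3 * f i1 == i) && (3 * f i2 == i))%N =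
      ((N - i + 3 * f i1 == N) && (N - i + 3 * f i2 == N))%N); last by lia.
    rewrite -coef_monomial2; congr ((polyseq (polyseq _)`_N)`_N).
    rewrite big_ord3 /xyz /= !expr1n !mul1r -!exprM exprMn.
    rewrite mulrnAr -mulrnA !rmorphMn mulrnAl /=; congr (_ *+ _); last exact: mulnC.
    rewrite (exprD 'X) (exprD 'X%:P) !rmorphXn !rmorphN !rmorph_nat /=.
    by rewrite exprMn -mulrA mulrACA.
  rewrite /c; case: ifP => [/dvdnP[k ik]|hi3]; last first.
    apply: big1 => f _; case: eqP => [e|]; last by rewrite mulr0n.
    by rewrite -e dvdn_mulr in hi3.
  have ki : (k < i.+1)%N by lia.
  rewrite (bigD1 [ffun=> inord k]); last first.
    by rewrite big_ord3 !ffunE /= inordK // ik; apply/eqP; lia.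
  rewrite big1 ?addr0 => [|f].
    rewrite !ffunE inordK // [in X in _ *+ X](_ : 3 * k = i)%N ?eqxx ?mulr1n; last by lia.
    have -> : (i %/ 3 = k)%N by rewrite ik mulnK.
    rewrite /= addr0; congr (_ *+ (_ * _)%N).
    by apply: eq_multinomial => j; rewrite ffunE inordK.
  have cst (g : 'I_3 -> nat) j : (\sum_l g l = i)%N ->
      (3 * g i1 = i)%N -> (3 * g i2 = i)%N -> g j = k.
    rewrite big_ord3 /= => e0 e1 e2.
    have : j \in [:: i0; i1; i2] by rewrite !inE; case: j => [[|[|[]]]].
    by rewrite !inE => /or3P[] /eqP->; lia.
  move=> /andP[/eqP fi]; case: andP => [[/eqP f1 /eqP f2]|]; last by rewrite mulr0n.
  case/eqP; apply/ffunP => j; apply: ord_inj; rewrite ffunE inordK //.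
  exact: cst fi f1 f2.
rewrite -(big_mkord xpredT c) (@zagierB_sum_wide N N.+1); last by lia.
(* The added indices exceed [N], so their binomial coefficient vanishes; the longer range suits
   [big_dvdn3]. *)
transitivity (\sum_(0 <= i < 3 * N.+1) c i).
  rewrite [RHS](@big_cat_nat _ _ _ N.+1) //=; last by lia.
  rewrite [X in _ = _ + X]big_nat_cond [X in _ = _ + X]big1 ?addr0 // => i.
  by rewrite andbT => /andP[hi _]; rewrite /c bin_small // mul0n mulr0n if_same.
rewrite -big_mkcond big_dvdn3 rmorph_sum mulr_sumr; apply: eq_bigr => k _ /=.
rewrite mulKn // multinomial_const3.
case: (leqP (3 * k) N) => [hk|hk]; last first.
  by rewrite zagierB_term_small // bin_small // mul0n mulr0n mulr0.
rewrite /zagierB_term !rmorphM !rmorphXn /= !mulrA exprNn.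
rewrite -[LHS]mulr_natr !natrM !mulrA rmorphN1 -!pmulrn; congr (_ * _ * _ * _ * _).
(* The signs agree because [N - 3 k] and [N + k] have the same parity. *)
rewrite -exprD -[LHS]signr_odd -[RHS]signr_odd; congr (_ ^+ nat_of_bool _).
by rewrite oddD oddB // oddM.
Qed.

(* The value of [w ^+ e + w ^+ (2 * e)] for a primitive cube root of unity [w]. *)
Definition trace_weight (e : nat) : int := if (3 %| e)%N then 2 else -1.

(** Adding the expansions for [w] and [w ^+ 2], the two primitive cube roots of unity, replaces each
    power of [w] by its integer trace, at the cost of the factor 2. *)
Lemma zagierB_table N :
  2 * (-1) ^+ N * zagierB_sum N
    = \sum_(M : table N | magic N (entries M))
        trace_weight (moment (entries M)) * (table_weight (entries M))%:Z.
Proof.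
have [w pw] := @C_prim_root_exists 3 isT.
have w3 : w ^+ 3 = 1 by apply: prim_expr_order.
have hw : 1 + w + w ^+ 2 = 0.
  have w1 : w - 1 != 0.
    by rewrite subr_eq0 -[w]expr1 -(prim_order_dvd pw).
  apply: (mulfI w1); rewrite mulr0; transitivity (w ^+ 3 - 1); first by ring.
  by rewrite w3 subrr.
have hw2 : 1 + w ^+ 2 + (w ^+ 2) ^+ 2 = 0.
  by rewrite -exprM (_ : 2 * 2 = 3 + 1)%N // exprD w3 mul1r expr1 -addrA [_ + w]addrC addrA.
have expand (u : algC) : 1 + u + u ^+ 2 = 0 ->
    (-1) ^+ N * (zagierB_sum N)%:~R = \sum_(M : table N | magic N (entries M))
        u ^+ moment (entries M) *+ table_weight (entries M).
  move=> hu; rewrite -constant_term_zagierB -table_sum.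
  have hP : 1 + u%:P%:P + u%:P%:P ^+ 2 = 0 :> {poly {poly algC}}.
    have := congr1 (fun c : algC => c%:P%:P) hu.
    by rewrite !rmorphD !rmorphXn !rmorph1 !rmorph0.
  rewrite -(cubic_factor _ hP).
  congr ((polyseq (polyseq (_ ^+ N))`_N)`_N); apply: eq_bigr => i _.
  by apply: eq_bigr => j _; rewrite !rmorphXn.
apply: (@intr_inj algC); rewrite !rmorphM rmorphXn rmorphN1 /= -mulrA.
rewrite [2%:~R](_ : _ = 1 + 1) // mulrDl mul1r {1}(expand _ hw) (expand _ hw2).
rewrite -big_split rmorph_sum; apply: eq_bigr => M _ /=.
rewrite -mulrnDl rmorphM /= -[LHS]mulr_natr -pmulrn; congr (_ * _).
rewrite -exprM /trace_weight /dvdn; move: (moment _) => e.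
rewrite -(prim_expr_mod pw e) -(prim_expr_mod pw (2 * e)%N) -modnMmr.
have : (e %% 3 < 3)%N by rewrite ltn_mod.
case: (e %% 3)%N => [|[|[|//]]] _ /=.
- by rewrite expr0.
- by rewrite expr1 rmorphN1 -[RHS]addr0 -hw; ring.
by rewrite expr1 rmorphN1 -[RHS]addr0 -hw; ring.
Qed.

(** * Restriction to tables with all entries divisible by [p] *)

Lemma eq_table_weight (I : finType) (m m' : I -> I -> nat) :
  (forall i j, m i j = m' i j) -> table_weight m = table_weight m'.
Proof. by move=> e; apply: eq_bigr => i _; apply: eq_multinomial => j. Qed.

Lemma eq_moment m m' : (forall i j, m i j = m' i j) -> moment m = moment m'.
Proof.
by move=> e; apply: eq_bigr => i _; apply: eq_bigr => j _; rewrite e.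
Qed.

Lemma eq_magic (I : finType) N (m m' : I -> I -> nat) :
  (forall i j, m i j = m' i j) -> magic N m = magic N m'.
Proof.
move=> e; congr (_ && _); apply: eq_forallb => i; congr (_ == _);
  by apply: eq_bigr => j _; rewrite e.
Qed.

Lemma entries_le N (M : table N) i j : (entries M i j <= N)%N.
Proof. exact: ltnSE (ltn_ord _). Qed.

(** The bijection multiplies or divides all entries by [p]; invariance of [F] under pointwise
    equality takes the place of function extensionality. *)
Lemma table_sum_scale p N (F : ('I_3 -> 'I_3 -> nat) -> int) : (0 < p)%N ->
  (forall m m', (forall i j, m i j = m' i j) -> F m = F m') ->
  \sum_(M : table (p * N) | magic (p * N) (entries M)
      && [forall i, forall j, (p %| entries M i j)%N]) F (entries M)
    = \sum_(M : table N | magic N (entries M)) F (fun i j => p * entries M i j)%N.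
Proof.
move=> p0 eqF.
pose h (M : table N) : table (p * N) := [ffun i => [ffun j => inord (p * M i j)]].
pose h' (M : table (p * N)) : table N := [ffun i => [ffun j => inord (M i j %/ p)]].
have hE M i j : entries (h M) i j = (p * entries M i j)%N.
  by rewrite {1}/entries !ffunE inordK // ltnS leq_mul // entries_le.
have h'E M i j : entries (h' M) i j = (entries M i j %/ p)%N.
  rewrite {1}/entries !ffunE inordK // ltnS -/(entries M i j).
  by rewrite (leq_trans (leq_div2r p (entries_le M i j))) // mulKn.
rewrite (reindex_onto h h') => [|M /andP[_ /'forall_forallP pM]]; last first.
  apply/ffunP => i; apply/ffunP => j; apply: ord_inj.
  by rewrite -!/(entries _ _ _) hE h'E mulnC divnK.
apply: eq_big => [M|M _]; last by apply: eqF => i j; rewrite hE.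
have -> : h' (h M) == M.
  apply/eqP/ffunP => i; apply/ffunP => j; apply: ord_inj.
  by rewrite -!/(entries _ _ _) h'E hE mulKn.
rewrite (eq_magic _ (hE M)) magic_scale // andbT.
case: magic => //=; apply/'forall_forallP => i j.
by rewrite hE dvdn_mulr.
Qed.

Lemma moment_scale p m : moment (fun i j => p * m i j)%N = (p * moment m)%N.
Proof.
rewrite /moment big_distrr; apply: eq_bigr => i _; rewrite big_distrr.
by apply: eq_bigr => j _ /=; rewrite mulnCA.
Qed.

(** The factor [p] stays inside [trace_weight], so that [p = 3] can be separated from the other
    primes afterwards. *)
Lemma zagierB_table_congr p r N : prime p -> (2 < p)%N -> (p ^ r %| N)%N ->
  ((p ^ (2 * r.+1))%N%:Z %| 2 * (-1) ^+ (p * N)%N * zagierB_sum (p * N)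
     - \sum_(M : table N | magic N (entries M))
         trace_weight (p * moment (entries M)) * (table_weight (entries M))%:Z)%Z.
Proof.
move=> pp p2 pN; rewrite zagierB_table.
rewrite (bigID (fun M : table (p * N) => [forall i, forall j, (p %| entries M i j)%N])) /=.
rewrite (@table_sum_scale p N (fun m => trace_weight (moment m) * (table_weight m)%:Z))
  ?prime_gt0 //; last by move=> m m' e; rewrite (eq_moment e) (eq_table_weight e).
rewrite addrAC -sumrB; apply: rpredD.
  apply: rpred_sum => M mM; rewrite moment_scale -mulrBr dvdz_mull //.
  by apply/eqz_nat_mod/(table_weight_mod _ _ pN mM).
apply: rpred_sum => M /andP[mM /forallPn[i /forallPn[j hij]]]; rewrite dvdz_mull //.
(* With [s = 0], an entry prime to [p] brings in the full power [p ^ (2 * r.+1)], since [p ^ r.+1]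
   divides [p * N]. *)
apply: (@dvdn_table_weight _ p r.+1 0 _ _ i j _ _ mM) => //.
by rewrite expnS dvdn_mul.
Qed.

(** * Cyclic shifts of columns, for the prime 3 *)

Definition column_moment (m : 'I_3 -> 'I_3 -> nat) (j : 'I_3) : nat :=
  (\sum_(i < 3) i * m i j)%N.

Lemma moment_columns m :
  moment m = (column_moment m i1 + 2 * column_moment m i2)%N.
Proof. by rewrite /moment /column_moment !big_ord3 /=; lia. Qed.

(** Summing along rows first gives [0 N + 1 N + 2 N]. Hence the column moments add up to 0 modulo
    3. *)
Lemma sum_column_moment N m : magic N m ->
  (column_moment m i0 + column_moment m i1 + column_moment m i2 = 3 * N)%N.
Proof.
case/magicP => rows _; have := rows i1; have := rows i2.
by rewrite /column_moment !big_ord3 /=; lia.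
Qed.

Definition shift_columns N (M : table N) : table N :=
  [ffun i => [ffun j => M i (ordS j)]].

Lemma shift_columns_bij N : bijective (@shift_columns N).
Proof.
exists (fun M : table N => [ffun i => [ffun j => M i (ord_pred j)]]) => M;
  by apply/ffunP => i; apply/ffunP => j; rewrite !ffunE ?ordSK ?ord_predK.
Qed.

Lemma entries_shift N (M : table N) i j :
  entries (shift_columns M) i j = entries M i (ordS j).
Proof. by rewrite /entries !ffunE. Qed.

Lemma magic_shift N (M : table N) :
  magic N (entries (shift_columns M)) = magic N (entries M).
Proof.
rewrite (eq_magic _ (entries_shift M)); apply/magicP/magicP => -[rows cols]; split=> i.
- rewrite -[RHS](rows i) [LHS](reindex (@ordS 3)) //; exact: onW_bij (ordS_bij 3).
- by rewrite -[i]ord_predK; apply: cols.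
- rewrite -[RHS](rows i) [RHS](reindex (@ordS 3)) //; exact: onW_bij (ordS_bij 3).
exact: cols.
Qed.

Lemma table_weight_shift N (M : table N) :
  table_weight (entries (shift_columns M)) = table_weight (entries M).
Proof.
rewrite (eq_table_weight (entries_shift M)); apply: eq_bigr => i _.
exact: (multinomial_bij (entries M i) (ordS_bij 3)).
Qed.

(* If [3] does not divide the moment of a magic table, its column moments are
   distinct modulo [3], so exactly one of the three cyclic shifts of its columns
   has first column moment divisible by [3]. *)
Lemma sum_table_shift N :
  \sum_(M : table N | magic N (entries M) && ~~ (3 %| moment (entries M))%N)
      (table_weight (entries M))%:Z
    = 3 * \sum_(M : table N | magic N (entries M) && ~~ (3 %| moment (entries M))%N
                              && (3 %| column_moment (entries M) i0)%N)
        (table_weight (entries M))%:Z.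
Proof.
pose F (M : table N) := (table_weight (entries M))%:Z; rewrite -!/(F _).
set P := (fun M : table N => magic N (entries M) && ~~ (3 %| moment (entries M))%N).
pose A j := \sum_(M | P M && (3 %| column_moment (entries M) j)%N) F M.
have colS M j : column_moment (entries (shift_columns M)) j
    = column_moment (entries M) (ordS j).
  by apply: eq_bigr => i _; rewrite entries_shift.
have S0 : ordS i0 = i1 by apply: val_inj.
have S1 : ordS i1 = i2 by apply: val_inj.
have S2 : ordS i2 = i0 by apply: val_inj.
(* With column moments [c0], [c1], [c2], the shift turns the moment [c1 + 2 c2] into [c2 + 2 c0],
   which is congruent to it modulo 3 because [c0 + c1 + c2] is 0. *)
have PS M : P (shift_columns M) = P M.
  rewrite /P magic_shift; case: (boolP (magic _ _)) => //= /sum_column_moment.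
  by rewrite !moment_columns !colS S1 S2; lia.
have AS j : A j = A (ordS j).
  rewrite /A [LHS](reindex (@shift_columns N)); last exact: onW_bij (shift_columns_bij N).
  by apply: eq_big => [M|M _]; rewrite /F ?table_weight_shift // PS colS.
have -> : \sum_(M | P M) F M = \sum_j A j.
  rewrite /A; under [RHS]eq_bigr do rewrite big_mkcondr.
  rewrite exchange_big; apply: eq_bigr => M /andP[/sum_column_moment].
  rewrite big_ord3 /= moment_columns => e m3.
  case: (boolP (3 %| _)%N) => h0; case: (boolP (3 %| _)%N) => h1;
  case: (boolP (3 %| _)%N) => h2; rewrite ?addr0 ?add0r //; exfalso; lia.
rewrite big_ord3 /= -/(A i0) -S1 -AS -S0 -AS; ring.
Qed.

(** * The congruence for the sequence *)

Lemma zagierB_sum_congr p r N : prime p -> (2 < p)%N -> (p ^ r %| N)%N ->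
  ((p ^ (2 * r.+1))%N%:Z %| zagierB_sum (p * N) - zagierB_sum N)%Z.
Proof.
move=> pp p2 pN; have oddp : odd p.
  by apply: contraTT p2 => /(prime_oddPn pp) ->.
(* As [p] is odd, [2 * (-1) ^+ N] is a unit modulo [p], so multiplying by it loses nothing and makes
   [zagierB_table] applicable. *)
have cz : coprimez (p ^ (2 * r.+1))%N%:Z (2 * (-1) ^+ N).
  by rewrite /coprimez; apply: coprimeXl; rewrite abszM abszX /= exp1n muln1 coprimen2.
rewrite -(Gauss_dvdzr _ cz) mulrBr zagierB_table.
have := zagierB_table_congr pp p2 pN.
have -> : (-1) ^+ (p * N)%N = (-1) ^+ N :> int.
  by rewrite -signr_odd oddM oddp signr_odd.
set S := \sum_(M | _) _; set S' := \sum_(M | _) _ => h.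
case: (eqVneq p 3%N) => [p3|p3]; last first.
  suff -> : S' = S by [].
  (* For [p] other than 3, multiplying the moment by [p] does not affect its divisibility by 3. *)
  apply: eq_bigr => M _; rewrite /trace_weight Gauss_dvdr //.
  by rewrite prime_coprime // dvdn_prime2 // eq_sym.
have -> : 2 * (-1) ^+ N * zagierB_sum (p * N) - S'
  = (2 * (-1) ^+ N * zagierB_sum (p * N) - S) + (S - S') by ring.
apply: rpredD h _; rewrite /S /S' -sumrB.
(* For [p = 3] the scaled moment always has trace weight 2; the weights differ only at moments prime
   to 3, by [2 - (-1) = 3]. *)
have -> : \sum_(M : table N | magic N (entries M))
     (trace_weight (p * moment (entries M)) * (table_weight (entries M))%:Z
        - trace_weight (moment (entries M)) * (table_weight (entries M))%:Z)
   = 3 * \sum_(M : table N | magic N (entries M) && ~~ (3 %| moment (entries M))%N)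
     (table_weight (entries M))%:Z.
  rewrite [in RHS]big_mkcondr mulr_sumr; apply: eq_bigr => M _.
  rewrite /trace_weight p3 dvdn_mulr //; case: ifP => _ /=; ring.
rewrite sum_table_shift mulrA.
(* One factor 3 is this difference, the other comes from [sum_table_shift]; each weight supplies
   [3 ^ (2 * r)]. *)
rewrite p3 (_ : 2 * r.+1 = 2 + 2 * r)%N; last lia.
rewrite (expnD 3 2) PoszM.
apply: dvdz_mul => //; apply: rpred_sum => M /andP[/andP[mM m3] _].
(* If 3 divided every entry, it would divide the moment; so [dvdn_table_weight] applies with
   [s = 0]. *)
have /forallPn[i /forallPn[j hij]] : ~~ [forall i, forall j, 3 ^ 1 %| entries M i j]%N.
  apply: contra m3 => /'forall_forallP h; apply: dvdn_sum => i _.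
  by apply: dvdn_sum => j _; apply: dvdn_mull (h i j).
rewrite p3 in pN.
by have := dvdn_table_weight (isT : prime 3) pN mM hij; rewrite subn0.
Qed.

(** The leading coefficient [(n + 2) ^+ 2] is nonzero, so each value is determined by the two before
    it; the induction carries two consecutive values. *)
Lemma zagierB_spec_unique (B : int -> int) (n : nat) :
  zagierB_spec B -> B n = zagierB_sum n.
Proof.
case=> _ B0 rec.
have s0 : zagierB_sum 0 = 1 by rewrite /zagierB_sum big_nat1.
have s1 : zagierB_sum 1 = 3.
  by rewrite /zagierB_sum big_nat1 /zagierB_term !muln0 !bin0 expr0 expr1.
have B1 : B 1 = 3.
  have := rec 0 isT; rewrite B0 add0r => e.
  apply/eqP; rewrite -subr_eq0 -[X in _ == X]e; apply/eqP; ring.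
suff [] : B n = zagierB_sum n /\ B n.+1 = zagierB_sum n.+1 by [].
elim: n => [|n [IH1 IH2]]; first by rewrite s0 s1.
split=> //; have := rec n.+1 isT; have := zagierB_sum_rec n.
have -> : n.+1%:Z + 1 = n.+2%:Z by lia.
have -> : n.+1%:Z - 1 = n%:Z by lia.
rewrite IH1 IH2 => h1 h2.
have n2 : (n%:Z + 2) ^+ 2 != 0 by rewrite expf_neq0 //; lia.
apply: (mulfI n2); apply/eqP; rewrite -subr_eq0 -[X in _ == X](subrr 0) -{1}h2 -h1.
have -> : n.+2%:Z = n%:Z + 2 :> int by lia.
have -> : n.+1%:Z = n%:Z + 1 by lia.
by apply/eqP; ring.
Qed.

Theorem theorem1p4 (B : int -> int) (hB : zagierB_spec B)
    (p : nat) (p_prime : prime p) (p_ge3 : (3 <= p)%N)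
    (n k : nat) (n_ge1 : (1 <= n)%N) (k_ge1 : (1 <= k)%N) :
  (B (n * p ^ k)%N%:Z = B (n * p ^ (k - 1))%N%:Z %[mod (p ^ (2 * k))%N%:Z])%Z.
Proof.
case: k k_ge1 => // k _; rewrite subn1 !(zagierB_spec_unique _ hB) /=.
(* The exponent is now [k.+1], so the congruence is needed for [N = n * p ^ k] and [r = k]. *)
rewrite expnS mulnCA; apply/eqP; rewrite eqz_mod_dvd.
by apply: zagierB_sum_congr => //; apply: dvdn_mull.
Qed.
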